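(* Let $k \geq 2$ and let $G = (\{a,b\}, \varphi, a)$ be a circular D0L-system in which the morphism $\varphi$ is $k$-uniform. Let $d$ denote the least divisor of $k$ greater than $1$. Then the minimal synchronizing delay $Z_{\min}$ of $G$ satisfies: (i) $Z_{\min} \leq 8$ if $k = 2$; (ii) $Z_{\min} \leq k^2 + 3k - 4$ if $k$ is an odd prime; (iii) $Z_{\min} \leq k^2\left(\frac{k}{d} - 1\right) + 5k - 4$ otherwise.
   Context: A D0L-system is a triple $G=(\mathcal{A},\varphi,w)$ with $\mathcal{A}$ a finite alphabet, $\varphi:\mathcal{A}^*\to\mathcal{A}^*$ a morphism and $w\in\mathcal{A}^+$ (the axiom). Its language is $L(G)=\{\varphi^n(w): n\in\mathbb{N}\}$ and $S(L(G))$ is the set of all factors of words of $L(G)$; the alphabet is assumed minimal, i.e. every letter of $\mathcal{A}$ belongs to $S(L(G))$. $G$ is a PD0L-system if $\varphi(c)\neq\varepsilon$ for all $c\in\mathcal{A}$. $G$ is injective on $S(L(G))$ if $\varphi(u)=\varphi(v)$ with $u,v\in S(L(G))$ implies $u=v$. For $u\in S(L(G))$, an interpretation of $u$ is a triple $(p,v,s)$ with $p,s\in\mathcal{A}^*$, $v\in S(L(G))$ and $\varphi(v)=pus$. Writing $v=v_1\cdots v_n$, $v'=v'_1\cdots v'_m$, $u=u_1\cdots u_\ell$ (letters), two interpretations $(p,v,s)$, $(p',v',s')$ of $u$ are synchronized at position $j$ ($0\le j\le \ell$) if there are indices $i,i'$ with $\varphi(v_1\cdots v_i)=p\,u_1\cdots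 u_j$ and $\varphi(v'_1\cdots v'_{i'})=p'\,u_1\cdots u_j$ (empty products are $\varepsilon$). The word $u$ has a synchronizing point at position $j$ if all its interpretations are pairwise synchronized at position $j$. A PD0L-system injective on $S(L(G))$ is circular if there is a positive integer $Z$ (a synchronizing delay) such that every $u\in S(L(G))$ with $|u|>Z$ has a synchronizing point; $Z_{\min}$ denotes the least such $Z$. A morphism $\varphi$ on $\{a,b\}$ is $k$-uniform if $|\varphi(a)|=|\varphi(b)|=k$. *)

(* Defs.v *)
From mathcomp Require Import all_boot.
Set Implicit Arguments. Unset Strict Implicit. Unset Printing Implicit Defensive.

Definition la : bool := true.
Definition lb : bool := false.

Section D0L.
Variable phi : bool -> seq bool.

Definition morph (w : seq bool) : seq bool := flatten (map phi w).

Definition morphn (n : nat) (w : seq bool) : seq bool := iter n morph w.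

Definition inS (w u : seq bool) : Prop := exists n, infix u (morphn n w).

Definition minimal_alphabet (w : seq bool) : Prop := inS w [:: la] /\ inS w [:: lb].

Definition PD0L : Prop := forall c, phi c != [::].

Definition injective_on_S (w : seq bool) : Prop :=
  forall u v, inS w u -> inS w v -> morph u = morph v -> u = v.

Definition interpretation (w u p v s : seq bool) : Prop :=
  inS w v /\ morph v = p ++ u ++ s.

Definition synchronized_at (u p v p' v' : seq bool) (j : nat) : Prop :=
  exists i i', [/\ i <= size v, i' <= size v',
    morph (take i v) = p ++ take j u &
    morph (take i' v') = p' ++ take j u].

Definition sync_point (w u : seq bool) (j : nat) : Prop :=
  j <= size u /\
  forall p v s p' v' s', interpretation w u p v s -> interpretation w u p' v' s' ->
    synchronized_at u p v p' v' j.

Definition sync_delay (w : seq bool) (Z : nat) : Prop :=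
  0 < Z /\ forall u, inS w u -> Z < size u -> exists j, sync_point w u j.

Definition circular (w : seq bool) : Prop :=
  PD0L /\ injective_on_S w /\ exists Z, sync_delay w Z.

Definition is_Zmin (w : seq bool) (Z : nat) : Prop :=
  sync_delay w Z /\ forall Z', sync_delay w Z' -> Z <= Z'.

Definition uniform (k : nat) : Prop := size (phi la) = k /\ size (phi lb) = k.
End D0L.

(* Main.v *)
(* Two interpretations of a long factor whose prefixes have different lengths modulo [k] give
   words V and W of the language with phi (W i) = drop r (phi (V i)) ++ take r (phi (V i.+1)),
   0 < r < k.  If V contained three different two-letter factors, then phi a and phi b would
   have a common prefix of length r or a common suffix of length k - r, and then the equation
   forces phi a = phi b.  So V is alternating, or a run c^n up to one extreme letter.
   A run is transported to a run of e with phi e = rot r (phi c).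
   - If e = c, then phi c is a proper power, and its period limits the runs of c unless
     they are unbounded.
   - If e <> c, then phi a and phi b are conjugate, and counting letters limits the two runs.
   - If V alternates, then phi (ab) is an odd power of a word of even length, which limits
     alternation unless it is unbounded.
   Unbounded runs or alternations yield desynchronized words of every length, against
   circularity.  The bounds are k n + 4 (k - 1) with n = 2, k - 1 and k (k / d - 1) + 1. *)
Require Import Defs.
From mathcomp Require Import all_boot.
From mathcomp Require Import zify.

Set Implicit Arguments. Unset Strict Implicit. Unset Printing Implicit Defensive.

(** * Commuting words, periods and residues *)

(** A word commuting with [p] is a prefix of every long enough power of [p], so its length
    determines it. *)
Lemma commuting_same_size (T : Type) (p x y : seq T) :
  0 < size p -> p ++ x = x ++ p -> p ++ y = y ++ p -> size x = size y -> x = y.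
Proof.
move=> p0; pose P m := iter m (cat p) [::].
have sP m : size (P m) = m * size p by elim: m => //= m; rewrite size_cat => ->; lia.
have comP z m : p ++ z = z ++ p -> P m ++ z = z ++ P m.
  by move=> E; elim: m => [|m IH]; rewrite /= ?cats0 // -catA IH !catA E.
have takeP z : p ++ z = z ++ p -> z = take (size z) (P (size z)).
  move=> E; have := congr1 (take (size z)) (comP z (size z) E).
  have zP : size z <= size (P (size z)) by rewrite sP; nia.
  by rewrite (takel_cat _ zP) take_size_cat // => ->.
by move=> Ex Ey Es; rewrite (takeP x Ex) (takeP y Ey) Es.
Qed.

(* In the crossed case [p ++ p] commutes with [x] and with [y]. *)
Lemma shared_factor_eq (T : Type) (p x y : seq T) :
  0 < size p -> size x = size y ->
  (p ++ x = x ++ p /\ p ++ y = y ++ p) \/ (p ++ x = y ++ p /\ p ++ y = x ++ p) ->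
  x = y.
Proof.
move=> p0 Es [[Ex Ey]|[Ex Ey]]; first exact: (commuting_same_size p0).
apply: (@commuting_same_size _ (p ++ p)); rewrite ?size_cat ?addn_gt0 ?p0 //.
  by rewrite -catA Ex catA Ey -catA.
by rewrite -catA Ey catA Ex -catA.
Qed.

(** Bezout without subtraction: [u * r = v * m + gcdn r m], so after adding [v * m] a shift by the
    gcd is a shift by a multiple of [r]. *)
Lemma periodic_gcd (T : Type) (F : nat -> T) (r m : nat) :
  0 < r -> (forall i, F (i + r) = F i) -> (forall i, F (i + m) = F i) ->
  forall i, F (i + gcdn r m) = F i.
Proof.
move=> r0 Fr Fm i.
have it s : (forall i, F (i + s) = F i) -> forall q i, F (i + q * s) = F i.
  move=> Fs q; elim: q => [|q IH] j; first by rewrite addn0.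
  by rewrite mulSn addnA IH Fs.
case: (egcdnP m r0) => u v E _.
by rewrite -(it m Fm v) -addnA [gcdn r m + _]addnC -E it.
Qed.

Lemma periodic_modn (T : Type) (F : nat -> T) (g i : nat) :
  (forall i, F (i + g) = F i) -> F i = F (i %% g).
Proof.
move=> Fg; rewrite [in LHS](divn_eq i g) addnC.
by elim: (i %/ g) => [|q IH]; rewrite ?addn0 // mulSn addnCA addnC Fg.
Qed.

Lemma hits_residue (m r i : nat) : i < m -> exists2 t, t < m & (r + t) %% m = i.
Proof.
move=> im; have m0 : 0 < m by lia.
(* This is [i - r] modulo [m], with [r] reduced first because subtraction is truncated. *)
exists ((i + (m - r %% m)) %% m); first by rewrite ltn_mod.
rewrite modnDmr.
have -> : r + (i + (m - r %% m)) = (r %/ m).+1 * m + i.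
  have := ltn_pmod r m0; have := divn_eq r m; rewrite mulSn.
  by move: (r %/ m * m) (r %% m) => a b; lia.
by rewrite modnMDl modn_small.
Qed.

Lemma run_le_count (c : bool) (x : seq bool) (a b : nat) :
  b <= size x -> (forall i, a <= i < b -> nth true x i = c) -> b - a <= count_mem c x.
Proof.
move=> bx H; have [ab|/ltnW ab] := leqP b a; first by lia.
rewrite -[x](cat_take_drop a) -[drop a x](cat_take_drop (b - a)) !count_cat.
have -> : take (b - a) (drop a x) = nseq (b - a) c.
  apply: (@eq_from_nth _ true) => [|i].
    by rewrite size_takel ?size_nseq // size_drop leq_sub2r.
  rewrite size_takel ?size_drop ?leq_sub2r // => ib.
  by rewrite nth_take // nth_drop nth_nseq ib H //; lia.
by rewrite count_nseq /= eqxx mul1n addnCA leq_addr.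
Qed.

Lemma mkseq_const (T : Type) (c : T) (f : nat -> T) N :
  (forall i, i < N -> f i = c) -> mkseq f N = nseq N c.
Proof.
move=> H; apply: (@eq_from_nth _ c) => [|i]; rewrite ?size_mkseq ?size_nseq // => iN.
by rewrite nth_mkseq // nth_nseq iN H.
Qed.

(** * Factors of the language of an injective uniform morphism *)

Section Language.

Variables (phi : bool -> seq bool) (k : nat).
Hypothesis k_gt1 : 1 < k.
Hypothesis size_phi : forall c, size (phi c) = k.
Hypothesis phi_inj : injective phi.
Hypothesis letters : minimal_alphabet phi [:: la].

Notation S := (inS phi [:: la]).
Notation morph := (morph phi).

Lemma morph_cat u v : morph (u ++ v) = morph u ++ morph v.
Proof. by rewrite /Defs.morph map_cat flatten_cat. Qed.

Lemma size_morph v : size (morph v) = k * size v.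
Proof.
elim: v => [|c v IH]; first by rewrite muln0.
by rewrite -cat1s morph_cat size_cat IH /Defs.morph /= cats0 size_phi; lia.
Qed.

Lemma nth_morph v j : j < k * size v ->
  nth true (morph v) j = nth true (phi (nth true v (j %/ k))) (j %% k).
Proof.
elim: v j => [|c v IH] j; first by rewrite muln0.
move=> jv; rewrite /Defs.morph /= nth_cat size_phi.
have [jk|kj] := ltnP j k; first by rewrite divn_small // modn_small.
have E : (k + (j - k)) %/ k = ((j - k) %/ k).+1.
  by rewrite divnDl ?dvdnn // divnn ltnW.
rewrite -[in RHS](subnKC kj) E modnDl /= -IH //; move: jv => /=; lia.
Qed.

Lemma nth_phi_ext x y : (forall i, i < k -> nth true (phi x) i = nth true (phi y) i) ->
  x = y.
Proof.
move=> H; apply: phi_inj; apply: (@eq_from_nth _ true); rewrite !size_phi //.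
Qed.

Lemma S_infix u v : infix u v -> S v -> S u.
Proof. by move=> uv [n vn]; exists n; apply: infix_trans vn. Qed.

Lemma S_morph u : S u -> S (morph u).
Proof.
move=> [n /infixP [s [s' E]]]; exists n.+1.
by rewrite /morphn iterS -/(morphn _ _ _) E !morph_cat infix_infix.
Qed.

Lemma S_letter c : S [:: c].
Proof. by case: letters => ? ?; case: c. Qed.

(** Only the axiom may fail to be an image, and it is a single letter. *)
Lemma S_preimage u : S u -> 1 < size u -> exists2 v, S v & infix u (morph v).
Proof.
move=> [[|n] un] u1; first by have := size_infix un; rewrite /=; lia.
by exists (morphn phi n [:: la]) => //; exists n; apply: infix_refl.
Qed.

Lemma S_mkseq (f : nat -> bool) a M N : S (mkseq f N) -> a + M <= N ->
  S (mkseq (fun i => f (a + i)) M).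
Proof.
move=> SN aN; apply: S_infix SN.
have -> : mkseq (fun i => f (a + i)) M = take M (drop a (mkseq f N)).
  apply: (@eq_from_nth _ true); rewrite size_mkseq ?size_takel ?size_drop ?size_mkseq //; try lia.
  move=> i iM; rewrite nth_take // nth_drop !nth_mkseq //; lia.
exact: infix_trans (infix_take _ _) (infix_drop _ _).
Qed.

Lemma S_nth_run V a M c : S V -> a + M <= size V ->
  (forall i, i < M -> nth true V (a + i) = c) -> S (nseq M c).
Proof.
move=> SV aM H; rewrite -(mkseq_const H).
by apply: (@S_mkseq (nth true V) a M (size V)) => //; rewrite mkseq_nth.
Qed.

Lemma S_nseq_le M N c : S (nseq N c) -> M <= N -> S (nseq M c).
Proof.
move=> SN MN; apply: (S_nth_run (a := 0) SN); rewrite ?size_nseq // => i iM.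
by rewrite nth_nseq add0n; have -> : i < N by lia.
Qed.

Lemma desubstitution W : S W -> 1 < size W ->
  exists V r, [/\ S V, r < k,
    forall i, i < size W ->
      nth true W i = nth true (phi (nth true V ((r + i) %/ k))) ((r + i) %% k),
    r + size W <= k * size V & k * size V < r + size W + k].
Proof.
move=> SW W1; have [v Sv /infixP [s [s' E]]] := S_preimage SW W1.
have k0 : 0 < k by lia.
pose q := size s %/ k; pose r := size s %% k; pose l := (r + size W + k.-1) %/ k.
have rk : r < k by rewrite ltn_mod.
have sE : size s = q * k + r := divn_eq _ _.
have lE : l * k <= r + size W + k.-1 < l * k + k.
  have := divn_eq (r + size W + k.-1) k; rewrite -/l.
  have := ltn_pmod (r + size W + k.-1) k0.
  by move: (l * k) (_ %% k) => a b; lia.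
have szv : k * size v = size s + size W + size s'.
  by rewrite -size_morph E !size_cat addnA.
have lv : q + l <= size v.
  have : k * (q + l) < k * (size v).+1 by lia.
  by rewrite ltn_pmul2l // ltnS.
exists (take l (drop q v)), r.
have szV : size (take l (drop q v)) = l by rewrite size_takel // size_drop; lia.
split; rewrite ?szV //; try lia.
  by apply: S_infix Sv; apply: infix_trans (infix_take _ _) (infix_drop _ _).
move=> i iW; have -> : nth true W i = nth true (morph v) (size s + i).
  rewrite E nth_cat; have -> : size s + i < size s = false by lia.
  by rewrite addKn nth_cat iW.
rewrite nth_morph ?sE; last by lia.
rewrite -addnA modnMDl divnMDl // nth_take ?nth_drop //.
by rewrite ltn_divLR //; lia.
Qed.

(** * Desynchronized pairs and their shape *)

Definition overlap r N (V W : nat -> bool) := forall i, i < N ->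
  phi (W i) = drop r (phi (V i)) ++ take r (phi (V i.+1)).

(** Since [0 < r < k], block cuts of [W] never meet those of [V]. [V] has one letter more because
    the last block of [W] ends inside [phi (V N)]. *)
Definition desync N := exists r V W,
  [/\ 0 < r < k, S (mkseq V N.+1), S (mkseq W N) & overlap r N V W].

Lemma morph_overlap r N V W : overlap r N V W ->
  morph (mkseq V N.+1) =
  take r (phi (V 0)) ++ morph (mkseq W N) ++ drop r (phi (V N)).
Proof.
have rc f M : morph (mkseq f M.+1) = morph (mkseq f M) ++ phi (f M).
  by rewrite mkseqS -cats1 morph_cat [morph [:: _]]/= /Defs.morph /= cats0.
elim: N => [|N IH] H; first by rewrite /Defs.morph /= cats0 cat_take_drop.
rewrite rc IH => [|i iN]; last by apply: H; lia.
by rewrite (rc W) H // -!catA cat_take_drop.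
Qed.

(** The image of [W] is also a factor of the image of [V], at offset [r]; a common cut would make
    [r] a multiple of [k]. *)
Lemma sync_delay_no_desync Z : sync_delay phi [:: la] Z -> ~ desync Z.+1.
Proof.
case=> _ HZ [r [V [W [/andP [r0 rk] SV SW H]]]].
have E := morph_overlap H.
have [|j [js sync]] := HZ _ (S_morph SW).
  by rewrite size_morph size_mkseq; nia.
have I1 : interpretation phi [:: la] (morph (mkseq W Z.+1)) [::] (mkseq W Z.+1) [::].
  by split; rewrite ?cats0.
have [i [i' [_ _ /(congr1 size) + /(congr1 size)]]] := sync _ _ _ _ _ _ I1 (conj SV E).
rewrite !size_morph !size_cat (size_takel js) (@size_takel r) ?size_phi ?(ltnW rk) //.
rewrite /= add0n.
move: (size _) (size _) => b a E1 E2.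
have : k * a < k * b < k * a.+1 by rewrite mulnS; lia.
by rewrite !ltn_pmul2l ?(ltnW k_gt1) // ltnS; lia.
Qed.

Lemma overlap_pair_inj r N V W i j : overlap r N V W -> r <= k ->
  take r (phi true) != take r (phi false) ->
  drop r (phi true) != drop r (phi false) ->
  i < N -> j < N -> W i = W j -> V i = V j /\ V i.+1 = V j.+1.
Proof.
move=> H rk pN sN iN jN E; have := H _ jN; rewrite -E H // => /eqP.
rewrite eqseq_cat ?size_drop ?size_phi // => /andP [/eqP Es /eqP Ep].
split.
  by move: Es sN; case: (V i) (V j) => [] [] // ->; rewrite eqxx.
by move: Ep pN; case: (V i.+1) (V j.+1) => [] [] // ->; rewrite eqxx.
Qed.

(** Equal prefixes or equal suffixes turn the overlap equations into commutation relations.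
    Otherwise each letter of [W] determines a two-letter factor of [V], so at most two such factors
    occur. *)
Lemma overlap_shape r N V W : 0 < r < k -> overlap r N V W ->
  [\/ exists c, forall i, i < N -> V i = c,
      exists c, forall i, i < N -> V i.+1 = c |
      forall i, i < N -> V i.+1 = ~~ V i].
Proof.
move=> /andP [r0 rk] H.
have rk' : r <= k := ltnW rk.
have phiE c : phi c = take r (phi c) ++ drop r (phi c) by rewrite cat_take_drop.
have sp c : size (take r (phi c)) = r by rewrite size_takel // size_phi.
have ss c : size (drop r (phi c)) = k - r by rewrite size_drop size_phi.
have [pE|pN] := eqVneq (take r (phi true)) (take r (phi false)).
  have pE' c c' : take r (phi c) = take r (phi c') by case: c; case: c'.
  constructor 1; exists (V 0) => i iN; apply: contraTeq isT => VN.
  have N0 : 0 < N by lia.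
  suff sE : drop r (phi (V i)) = drop r (phi (V 0)).
    by case/eqP: VN; apply: phi_inj; rewrite (phiE (V i)) (phiE (V 0)) sE (pE' _ (V 0)).
  have Hi := H _ iN; have H0 := H _ N0; set q := take r (phi true).
  rewrite (phiE (W i)) (pE' _ true) (pE' (V i.+1) true) -/q in Hi.
  rewrite (phiE (W 0)) (pE' _ true) (pE' (V 1) true) -/q in H0.
  have canc (x y z : seq bool) : z = x ++ q -> z = y ++ q -> size x = size y -> x = y.
    by move=> -> /eqP + sE; rewrite eqseq_cat // => /andP [/eqP].
  have sV : size (drop r (phi (V i))) = size (drop r (phi (V 0))) by rewrite !ss.
  have VE : V i = ~~ V 0 by move: VN; case: (V i); case: (V 0).
  have [E|E] := eqVneq (W i) (W 0); first by apply: canc sV; [exact: Hi | rewrite E].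
  apply: (@shared_factor_eq _ q) => //; first by rewrite sp.
  have W0E : W 0 = ~~ W i by move: E; case: (W i); case: (W 0).
  (* Both [W i, W 0] and [V i, V 0] list the two letters. Matched in order, [q] commutes with both
     suffixes; matched crosswise, it exchanges them. *)
  have [WV|/eqP] := eqVneq (W i) (V i).
    by left; rewrite -[in LHS]WV Hi -H0 W0E WV VE negbK.
  have -> : (W i <> V i) <-> W i = V 0 by rewrite VE; case: (W i); case: (V 0).
  by move=> WV; right; rewrite -Hi -H0 W0E WV -VE.
have [sE|sN] := eqVneq (drop r (phi true)) (drop r (phi false)).
  have sE' c c' : drop r (phi c) = drop r (phi c') by case: c; case: c'.
  constructor 2; exists (V 1) => i iN; apply: contraTeq isT => VN.
  have N0 : 0 < N by lia.
  suff pE : take r (phi (V i.+1)) = take r (phi (V 1)).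
    by case/eqP: VN; apply: phi_inj; rewrite (phiE (V i.+1)) (phiE (V 1)) pE (sE' _ (V 1)).
  have Hi := H _ iN; have H0 := H _ N0; set q := drop r (phi true).
  rewrite (phiE (W i)) (sE' _ true) (sE' (V i) true) -/q in Hi.
  rewrite (phiE (W 0)) (sE' _ true) (sE' (V 0) true) -/q in H0.
  have canc (x y z : seq bool) : z = q ++ x -> z = q ++ y -> x = y.
    by move=> -> /eqP; rewrite eqseq_cat // => /andP [_ /eqP].
  have sV : size (take r (phi (V i.+1))) = size (take r (phi (V 1))) by rewrite !sp.
  have VE : V i.+1 = ~~ V 1 by move: VN; case: (V i.+1); case: (V 1).
  have [E|E] := eqVneq (W i) (W 0); first by apply: canc; [exact: Hi | rewrite E].
  apply: (@shared_factor_eq _ q) => //; first by rewrite ss; lia.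
  have W0E : W 0 = ~~ W i by move: E; case: (W i); case: (W 0).
  have [WV|/eqP] := eqVneq (W i) (V i.+1).
    by left; rewrite -Hi -H0 W0E WV VE negbK.
  have -> : (W i <> V i.+1) <-> W i = V 1 by rewrite VE; case: (W i); case: (V 1).
  by move=> WV; right; rewrite -Hi -H0 W0E WV -VE.
pose h x y := has (fun i => (V i == x) && (V i.+1 == y)) (iota 0 N).
have hN x y i : ~~ h x y -> i < N -> V i = x -> V i.+1 = y -> False.
  move=> /hasPn /(_ i); rewrite mem_iota => H1 iN Ex Ey.
  by move: H1; rewrite Ex Ey !eqxx /= => /(_ iN).
have hP x y : h x y -> exists2 i, i < N & V i = x /\ V i.+1 = y.
  by case/hasP => i; rewrite mem_iota => iN /andP [/eqP Ex /eqP Ey]; exists i.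
have no3 x1 y1 x2 y2 x3 y3 : h x1 y1 -> h x2 y2 -> h x3 y3 ->
    [&& (x1, y1) != (x2, y2), (x1, y1) != (x3, y3) & (x2, y2) != (x3, y3)] -> False.
  move=> /hP [i iN [Ex Ey]] /hP [j jN [Ex' Ey']] /hP [l lN [Ex2 Ey2]].
  have inj := overlap_pair_inj H rk' pN sN; subst.
  have : [\/ W i = W j, W i = W l | W j = W l].
    by case: (W i); case: (W j); case: (W l);
      first [by constructor 1|by constructor 2|by constructor 3].
  case=> /inj [] // -> ->; rewrite !eqxx ?andbF //.
have step x y i : i < N -> V i = x -> V i.+1 = y -> h x y.
  by move=> iN Ex Ey; apply/negPn/negP => /hN /(_ iN Ex Ey).
(* Two repeats exclude any change of letter; a single repeat leaves room for one direction of
   change, hence one extreme letter; no repeat means alternation. *)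
have [tt|ntt] := boolP (h true true); have [ff|nff] := boolP (h false false).
- constructor 1; exists (V 0); elim=> [//|i IH] iN.
  rewrite -IH ?(ltnW iN) //.
  case Ei: (V i); case Ei1: (V i.+1) => //; have := step _ _ _ (ltnW iN) Ei Ei1 => h1.
    by case: (no3 _ _ _ _ _ _ tt ff h1).
  by case: (no3 _ _ _ _ _ _ tt ff h1).
- have [tf|ntf] := boolP (h true false).
    constructor 1; exists true => i iN; case Ei: (V i) => //.
    case Ei1: (V i.+1); have := step _ _ _ iN Ei Ei1 => h1; last by rewrite h1 in nff.
    by case: (no3 _ _ _ _ _ _ tt tf h1).
  constructor 2; exists true => i iN; case Ei1: (V i.+1) => //.
  by case Ei: (V i); have := step _ _ _ iN Ei Ei1 => h1; [case/negP: ntf|case/negP: nff].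
- have [tf|ntf] := boolP (h true false).
    constructor 2; exists false => i iN; case Ei1: (V i.+1) => //.
    case Ei: (V i); have := step _ _ _ iN Ei Ei1 => h1; first by case/negP: ntt.
    by case: (no3 _ _ _ _ _ _ ff tf h1).
  constructor 1; exists false => i iN; case Ei: (V i) => //.
  by case Ei1: (V i.+1); have := step _ _ _ iN Ei Ei1 => h1; [case/negP: ntt|case/negP: ntf].
constructor 3 => i iN; case Ei: (V i); case Ei1: (V i.+1) => //;
  have := step _ _ _ iN Ei Ei1 => h1; [by case/negP: ntt|by case/negP: nff].
Qed.

(** * Bounds on runs of one letter *)

Lemma desubst_run M c : S (nseq M c) -> 1 < M ->
  exists V r, [/\ S V, r < k,
    forall q j, j < k -> r <= q * k + j < r + M ->
      nth true (phi (nth true V q)) j = c,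
    r + M <= k * size V & k * size V < r + M + k].
Proof.
move=> SM M1; have := desubstitution SM; rewrite size_nseq => /(_ M1) [V [r [SV rk H le lt]]].
exists V, r; split => // q j jk qj.
have := H (q * k + j - r); rewrite nth_nseq subnKC; last by lia.
have -> : q * k + j - r < M by lia.
by rewrite divnMDl ?modnMDl ?(divn_small jk) ?(modn_small jk) ?addn0 => [<-|]; lia.
Qed.

(** A run covering a whole block would give it [k > A] letters [c]; so the run meets at most two
    blocks, each contributing at most [A]. *)
Lemma run_bound c A M : (forall e, count_mem c (phi e) <= A) -> A < k -> 1 < M ->
  S (nseq M c) -> M <= 2 * A.
Proof.
move=> HA Ak M1 SM; have [V [r [SV rk H le lt]]] := desubst_run SM M1.
have [full|short] := leqP (2 * k) (r + M).
  have : k - 0 <= count_mem c (phi (nth true V 1)).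
    by apply: run_le_count => [|i ik]; rewrite ?size_phi //; apply: H; lia.
  by have := HA (nth true V 1); lia.
have c0 : minn k (r + M) - r <= count_mem c (phi (nth true V 0)).
  by apply: run_le_count => [|i ik]; rewrite ?size_phi ?geq_minl //; apply: H; lia.
have c1 : r + M - k - 0 <= count_mem c (phi (nth true V 1)).
  by apply: run_le_count => [|i ik]; rewrite ?size_phi; [lia|apply: H; lia].
by have := HA (nth true V 0); have := HA (nth true V 1); lia.
Qed.

(** As [m] divides [k], residues can be read inside blocks, and a run of length [m] meets every
    residue, also the one where all blocks carry [d]. *)
Lemma residue_no_run d m i : m %| k -> i < m -> 1 < m ->
  (forall e j, j < k -> j %% m = i -> nth true (phi e) j = d) ->
  ~ S (nseq m (~~ d)).
Proof.
move=> mk im m1 Hd SM; have [V [r [SV rk H le lt]]] := desubst_run SM m1.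
have [t tm E] := hits_residue r im.
have jk : (r + t) %% k < k by rewrite ltn_mod ltnW.
have := H ((r + t) %/ k) _ jk; rewrite -divn_eq Hd //; last by rewrite modn_dvdm.
have -> : r <= r + t < r + m by lia.
by case: d {Hd SM H} => /(_ isT).
Qed.

(** * Runs of [c] when [phi c] is periodic and [phi (~~ c)] is a power of [c] *)

Section PeriodicBlock.

Variables (c : bool) (m jc jd : nat).
Hypotheses (m_dvd : m %| k) (m_gt1 : 1 < m) (m_ltk : m < k).
Hypothesis per : forall i j, i < k -> j < k -> i = j %[mod m] ->
  nth true (phi c) i = nth true (phi c) j.
Hypotheses (jc_lt : jc < k) (nth_jc : nth true (phi c) jc = c).
Hypotheses (jd_lt : jd < k) (nth_jd : nth true (phi c) jd = ~~ c).
Hypothesis phi_other : phi (~~ c) = nseq k c.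

Lemma other_run_lt q : S (nseq q (~~ c)) -> q < m.
Proof.
move=> Sq; rewrite ltnNge; apply/negP => mq.
apply: (@residue_no_run c m (jc %% m)) (S_nseq_le Sq mq) => //.
  by rewrite ltn_mod ltnW.
move=> e j jk E; have [->|] := eqVneq e c; first by rewrite (per jk jc_lt E) nth_jc.
move=> ec; have -> : e = ~~ c by move: ec; case: e; case: (c).
by rewrite phi_other nth_nseq jk.
Qed.

(* A run of [~~ c] of length [m.-1] meets all residues modulo [m] but one. *)
Lemma isolated_letter j : S (nseq m.-1 (~~ c)) -> 2 < m -> j.+1 < k ->
  nth true (phi c) j = c -> nth true (phi c) j.+1 <> c.
Proof.
move=> Sm m2 jk Ej Ej1; have [|V [r [SV rk H _ _]]] := desubst_run Sm; first by lia.
have m0 : 0 < m by lia.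
have miss i t : i < k -> nth true (phi c) i = c -> (r + t) %% m = i %% m -> m.-1 <= t.
  move=> ik Ei E; rewrite leqNgt; apply/negP => tm.
  have lk : (r + t) %% k < k by rewrite ltn_mod ltnW.
  have := H ((r + t) %/ k) _ lk; rewrite -divn_eq.
  have -> : r <= r + t < r + m.-1 by lia.
  move=> /(_ isT).
  have [->|ne] := eqVneq (nth true V ((r + t) %/ k)) c.
    rewrite (per lk ik) ?modn_dvdm // Ei; by case: (c).
  have -> : nth true V ((r + t) %/ k) = ~~ c.
    by move: ne; case: (nth _ _ _); case: (c).
  by rewrite phi_other nth_nseq lk; case: (c).
have [t tm Et] := hits_residue r (ltn_pmod j m0).
have [t' tm' Et'] := hits_residue r (ltn_pmod j.+1 m0).
have tE : t = t' by have := miss j t (ltnW jk) Ej Et; have := miss _ t' jk Ej1 Et'; lia.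
have /eqP : j + 0 = j + 1 %[mod m] by rewrite addn0 addn1 -Et -Et' tE.
by rewrite eqn_modDl mod0n modn_small.
Qed.

Lemma run_in_block_lt a b : b <= k ->
  (forall j, a <= j < b -> nth true (phi c) j = c) -> b - a < m.
Proof.
move=> bk H; rewrite ltnNge; apply/negP => mab.
have m0 : 0 < m by lia.
have [t tm Et] := hits_residue a (ltn_pmod jd m0).
have abt : a <= a + t < b by lia.
have : nth true (phi c) (a + t) = nth true (phi c) jd by apply: per => //; lia.
by rewrite H // nth_jd; case: (c).
Qed.

Lemma run_in_block_le1 a b : S (nseq m.-1 (~~ c)) -> b <= k ->
  (forall j, a <= j < b -> nth true (phi c) j = c) -> b - a <= 1.
Proof.
move=> Sm bk H; have lt := run_in_block_lt bk H.
have [|ab] := leqP (b - a) 1; first by [].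
by case: (@isolated_letter a); rewrite ?H //; lia.
Qed.

(** Over a run of [c], the inner letters of the preimage are [~~ c], because [phi c] contains
    [~~ c]; fewer than [m] of them can be adjacent. An extreme letter [c] contributes fewer than [m]
    places, and at most one when the run of [~~ c] has length [m - 1]. *)
Lemma periodic_block_run_bound M : S (nseq M c) -> M <= k * (m - 1) + 2.
Proof.
move=> SM; rewrite leqNgt; apply/negP => bigM.
have kM : k < M by nia.
have [|V [r [SV rk H le lt]]] := desubst_run SM; first by lia.
have [l lE] : exists l, size V = l.+2.
  case: (size V) le => [|[|l]]; [lia|lia|by exists l].
rewrite lE in le lt.
have inner q : 0 < q <= l -> nth true V q = ~~ c.
  move=> ql; apply: contraTeq isT => ne; have E : nth true V q = c.
    by move: ne; case: (nth _ _ _); case: (c).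
  have := H q jd jd_lt; rewrite E nth_jd.
  have -> : r <= q * k + jd < r + M by nia.
  by case: (c) => /(_ isT).
(* Used as numbers: they count the extreme letters that prolong the inner run of [~~ c]. *)
pose b0 := nth true V 0 == ~~ c; pose b1 := nth true V l.+1 == ~~ c.
have Sq : S (nseq (b0 + l + b1) (~~ c)).
  apply: (S_nth_run (a := ~~ b0) SV); first by rewrite lE; case: b0; case: b1; lia.
  move=> i; have [i0|i0] := posnP (~~ b0 + i).
    by rewrite i0 => _; apply/eqP; rewrite -/b0; move: i0; case: (b0).
  have [il _|il iq] := leqP (~~ b0 + i) l; first by apply: inner; rewrite i0.
  have iE : ~~ b0 + i = l.+1 by move: il iq i0; case: (b0); case: (b1) => /=; lia.
  rewrite iE; apply/eqP; rewrite -/b1.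
  by move: il iq iE; case: (b0); case: (b1) => //=; lia.
have qm := other_run_lt Sq.
have notb (b e : bool) : (e == ~~ b) = false -> e = b by case: b; case: e.
(* Two partial blocks, each below [m], thus cost less than one full block. *)
have m2k : 2 * m <= k by case/dvdnP: m_dvd => [[|[|t]] E]; lia.
have kq : k * (b0 + l + b1) <= k * (m - 1) by rewrite leq_mul2l; lia.
have kq' : b0 + l + b1 < m.-1 -> k * (b0 + l + b1) + k <= k * (m - 1).
  by move=> lt'; rewrite -mulnSr leq_mul2l; lia.
have Sm : b0 + l + b1 >= m.-1 -> S (nseq m.-1 (~~ c)) by move=> ?; exact: S_nseq_le Sq _.
have left : b0 = false -> k - r < m /\ (m.-1 <= b0 + l + b1 -> k - r <= 1).
  move=> /notb E; have R j : r <= j < k -> nth true (phi c) j = c.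
    by move=> rj; have := H 0 j; rewrite E => -> //; lia.
  split=> [|/Sm S1]; [exact: run_in_block_lt R|exact: run_in_block_le1 R].
have right : b1 = false ->
    r + M - k * l.+1 < m /\ (m.-1 <= b0 + l + b1 -> r + M - k * l.+1 <= 1).
  move=> /notb E; have R j : 0 <= j < r + M - k * l.+1 -> nth true (phi c) j = c.
    by move=> rj; have := H l.+1 j; rewrite E => -> //; lia.
  have bk : r + M - k * l.+1 <= k by lia.
  rewrite -[r + M - _]subn0; split=> [|/Sm S1]; rewrite ?subn0.
    by have := run_in_block_lt bk R; rewrite subn0.
  by have := run_in_block_le1 S1 bk R; rewrite subn0.
have [Qm|Qm] := leqP m.-1 (b0 + l + b1).
  have k2 : k * (b0 + l + b1) = k * b0 + k * l + k * b1 by rewrite !mulnDr.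
  move: kq left right k2 {kq' Sm Sq qm}.
  case: (b0) Qm; case: (b1) => /= Qm kq left right k2;
    try (have {left} [_ /(_ Qm) L] := left erefl);
    try (have {right} [_ /(_ Qm) R] := right erefl); lia.
have k2 : k * (b0 + l + b1) = k * b0 + k * l + k * b1 by rewrite !mulnDr.
have {}kq := kq' Qm; move: kq left right k2 {kq' Sm Sq qm}.
by case: (b0) Qm; case: (b1) => /= Qm kq left right k2;
  try (have {left} [L _] := left erefl);
  try (have {right} [R _] := right erefl); lia.
Qed.

End PeriodicBlock.

(** * Images as streams of letters *)

Definition stream (V : nat -> bool) i := nth true (phi (V (i %/ k))) (i %% k).

Lemma streamE V q j : j < k -> stream V (q * k + j) = nth true (phi (V q)) j.
Proof.
move=> jk; have k0 : 0 < k by lia.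
by rewrite /stream divnMDl // modnMDl divn_small // modn_small // addn0.
Qed.

Lemma nth_shift r x y j : r < k -> j < k ->
  nth true (drop r (phi x) ++ take r (phi y)) j =
  if r + j < k then nth true (phi x) (r + j) else nth true (phi y) (r + j - k).
Proof.
move=> rk jk; rewrite nth_cat size_drop size_phi ltn_subRL nth_drop.
case: ifP => // rj; rewrite nth_take; last by lia.
by congr (nth _ _ _); lia.
Qed.

Lemma stream_shift r V q j : r < k -> j < k -> stream V (r + (q * k + j)) =
  nth true (drop r (phi (V q)) ++ take r (phi (V q.+1))) j.
Proof.
move=> rk jk; rewrite nth_shift //; case: ifP => rj.
  by rewrite -streamE //; congr stream; lia.
by rewrite -streamE; [congr stream; rewrite mulSn|]; lia.
Qed.

(** The block equations become an index shift by [r], to which period arguments apply. *)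
Lemma overlapP r N V W : r < k -> overlap r N V W <->
  (forall i, i < k * N -> stream W i = stream V (r + i)).
Proof.
move=> rk; have k0 : 0 < k by lia.
split=> H i iN.
  rewrite (divn_eq i k) stream_shift ?ltn_mod // -H ?streamE ?ltn_mod //.
  by rewrite ltn_divLR // mulnC.
apply: (@eq_from_nth _ true) => [|j].
  by rewrite size_cat size_drop size_takel ?size_phi //; lia.
rewrite size_phi => jk; rewrite -stream_shift // -H ?streamE //; nia.
Qed.

Lemma nth_morph_mkseq V N i : i < k * N -> nth true (morph (mkseq V N)) i = stream V i.
Proof.
move=> iN; rewrite nth_morph ?size_mkseq // nth_mkseq //.
by rewrite ltn_divLR; lia.
Qed.

Lemma S_power_unbounded m c : 1 < m ->
  (forall N, S (nseq N c) -> S (nseq (m * N) c)) -> forall N, S (nseq N c).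
Proof.
move=> m1 H N; apply: S_nseq_le (ltnW (ltn_expl N m1)).
by elim: N => [|N IH]; [exact: S_letter|rewrite expnS; apply: H].
Qed.

Lemma morph_nseq N c d : phi c = nseq k d -> morph (nseq N c) = nseq (k * N) d.
Proof.
move=> E; elim: N => [|N IH]; first by rewrite muln0.
by rewrite -[nseq N.+1 c]/([:: c] ++ nseq N c) morph_cat IH mulnS nseqD /Defs.morph /= E cats0.
Qed.

Lemma phi_nseqP c d :
  reflect (exists2 j, j < k & nth true (phi c) j = ~~ d) (phi c != nseq k d).
Proof.
apply: (iffP idP) => [|[j jk E]].
  rewrite -[k in nseq k](size_phi c) -[_ == _]/(_ == _).
  move/eqP/all_pred1P/allPn => [x /(nthP true) [j]]; rewrite size_phi => jk <- /= ne.
  by exists j => //; move: ne; case: (nth _ _ _); case: (d).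
by apply/eqP => E'; move: E; rewrite E' nth_nseq jk; case: (d).
Qed.

Lemma nth_rot r c i : r < k -> i < k ->
  nth true (rot r (phi c)) i = nth true (phi c) ((r + i) %% k).
Proof.
move=> rk ik; rewrite nth_shift //; case: ifP => ri; first by rewrite modn_small.
by rewrite -[in RHS](@subnK k (r + i)) ?modnDr ?modn_small //; lia.
Qed.

(** * A threshold beyond which desynchronization is unbounded *)

Section Threshold.

Variable n : nat.
Hypothesis n_ge : k <= n.+1.
Hypothesis n_odd : k = n.+1 -> odd k.
(* A block with period [m] can yield runs as long as [k * (m - 1) + 2]; the second bound
   makes every factor of length [n + 3] cover a full block. *)
Hypothesis n_div : forall m, m %| k -> 1 < m < k -> k * (m - 1) < n /\ 2 * k <= n + 3.

(** Dropping the possibly different extreme letter of [V] costs one letter of [V] and one of [W];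
    injectivity of [phi] makes the rest of [W] constant. *)
Lemma overlap_run r V W : 0 < r < k -> overlap r n.+2 V W ->
  S (mkseq V n.+3) -> S (mkseq W n.+2) ->
  (exists c e, [/\ S (nseq n.+2 c), S (nseq n.+1 e) & phi e = rot r (phi c)]) \/
  (forall i, i < n.+2 -> V i.+1 = ~~ V i).
Proof.
move=> rk H SV SW; case: (overlap_shape rk H) => [[c Vc]|[c Vc]|alt]; last by right.
- left; exists c, (W 0).
  have E0 : phi (W 0) = rot r (phi c) by rewrite H // !Vc.
  split=> //; first by rewrite -(mkseq_const Vc); apply: (@S_mkseq V 0 _ n.+3).
  have We i : i < n.+1 -> W (0 + i) = W 0.
    by move=> i_n; apply: phi_inj; rewrite E0 H ?Vc //; lia.
  by rewrite -(mkseq_const We); apply: (@S_mkseq W 0 _ n.+2).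
left; exists c, (W 1).
have E0 : phi (W 1) = rot r (phi c) by rewrite H // !Vc.
split=> //; first by rewrite -(mkseq_const Vc); apply: (@S_mkseq V 1 _ n.+3).
have We i : i < n.+1 -> W (1 + i) = W 1.
  by move=> i_n; apply: phi_inj; rewrite E0 H ?Vc //; lia.
by rewrite -(mkseq_const We); apply: (@S_mkseq W 1 _ n.+2).
Qed.

Lemma count_lt c d : (exists2 j, j < k & nth true (phi d) j = ~~ c) ->
  count_mem c (phi d) < k.
Proof.
case=> j jk E; rewrite ltn_neqAle -[X in _ <= X](size_phi d) count_size andbT.
rewrite -[X in _ != X](size_phi d) -all_count; apply/allPn.
by exists (nth true (phi d) j); rewrite ?mem_nth ?size_phi //= E; case: (c).
Qed.

(** Runs of [c] grow when [phi] or its square maps [c] to a power of [c]; in every other case a run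
    of length [n.+2] is impossible. *)
Lemma self_rotation_unbounded r c : 0 < r < k -> phi c = rot r (phi c) ->
  S (nseq n.+2 c) -> forall N, S (nseq N c).
Proof.
move=> /andP [r0 rk] rotE Sn; have k0 : 0 < k by lia.
have [cc|/phi_nseqP [jd jdk Ed]] := eqVneq (phi c) (nseq k c).
  apply: (@S_power_unbounded k) => // N SN; rewrite -(morph_nseq N cc); exact: S_morph.
have [cd|/phi_nseqP [jc jck Ec]] := eqVneq (phi c) (nseq k (~~ c)).
  have [dc|/phi_nseqP [j jk Ej]] := eqVneq (phi (~~ c)) (nseq k c).
    apply: (@S_power_unbounded (k * k)) => [|N SN]; first by nia.
    rewrite -mulnA -(morph_nseq _ dc) -(morph_nseq _ cd).
    by do 2!apply: S_morph.
  (* Every block has [~~ c] at place [j], which excludes a run of [k] letters [c]. *)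
  exfalso; apply: (@residue_no_run (~~ c) k j) => //; last first.
    by rewrite negbK; apply: S_nseq_le Sn _; lia.
  move=> e i ik; rewrite modn_small // => ->.
  have [->|ne] := eqVneq e c; first by rewrite cd nth_nseq jk.
  by have -> : e = ~~ c by move: ne; case: (e); case: (c).
rewrite negbK in Ec; exfalso.
(* [F] repeats [phi c] forever; it has periods [k] and [r], hence their gcd, which exceeds 1 because
   both letters occur. *)
pose F i := nth true (phi c) (i %% k).
have Fk i : F (i + k) = F i by rewrite /F modnDr.
have Fr i : F (i + r) = F i.
  by rewrite /F addnC -modnDmr -nth_rot ?ltn_mod // -rotE.
have Fm i : F i = F (i %% gcdn r k) by apply: periodic_modn; apply: periodic_gcd.
set m := gcdn r k in Fm.
have mk : m %| k by rewrite dvdn_gcdr.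
have m0 : 0 < m by rewrite gcdn_gt0 r0.
have FE i : i < k -> F i = nth true (phi c) i by move=> ik; rewrite /F modn_small.
have m1 : 1 < m.
  rewrite ltn_neqAle m0 andbT; apply/eqP => mE.
  have : F jc = F jd by rewrite Fm [in RHS]Fm -mE !modn1.
  by rewrite !FE // Ec Ed; case: (c).
have mltk : m < k by apply: leq_ltn_trans rk; apply: dvdn_leq => //; exact: dvdn_gcdl.
have [nb n2k] : k * (m - 1) < n /\ 2 * k <= n + 3 by apply: n_div; rewrite ?m1.
have [dc|/phi_nseqP dd] := eqVneq (phi (~~ c)) (nseq k c).
  have per i j : i < k -> j < k -> i = j %[mod m] ->
      nth true (phi c) i = nth true (phi c) j.
    by move=> ik jk E; rewrite -!FE // Fm E -Fm.
  have := periodic_block_run_bound mk m1 mltk per jck Ec jdk Ed dc Sn; lia.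
(* Both blocks contain [~~ c], so runs of [c] have length at most [2 * (k - 1)], below [n + 2]. *)
have HA e : count_mem c (phi e) <= k.-1.
  have [->|ne] := eqVneq e c; first by rewrite -ltnS prednK // count_lt //; exists jd.
  have -> : e = ~~ c by move: ne; case: (e); case: (c).
  by rewrite -ltnS prednK // count_lt.
have := run_bound HA _ _ Sn; lia.
Qed.

(** Rotation keeps letter counts. With [A] letters [c] per block the runs are at most [2 * A] and
    [2 * (k - A)], so [n.+1 <= k]; equality makes [k] even, against [n_odd]. *)
Lemma no_conjugate_runs r c : phi (~~ c) = rot r (phi c) ->
  S (nseq n.+1 c) -> S (nseq n.+1 (~~ c)) -> False.
Proof.
move=> rotE Sc Sd; pose A := count_mem c (phi c).
have cE e : count_mem c (phi e) = A.
  have [->|ne] := eqVneq e c; first by [].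
  have -> : e = ~~ c by move: ne; case: (e); case: (c).
  by rewrite rotE /rot count_cat addnC -count_cat cat_take_drop.
have dE e : count_mem (~~ c) (phi e) = k - A.
  rewrite -(cE e) -(size_phi e) -(count_predC (pred1 c) (phi e)) addKn.
  by apply: eq_count => x /=; case: (c); case: x.
have neq : phi (~~ c) <> phi c by move/phi_inj; case: (c).
have not_const d : phi c != nseq k d.
  apply/eqP => E; apply: neq; have /all_pred1P -> : all (pred1 d) (phi (~~ c)).
    by rewrite rotE E /rot all_cat andbC -all_cat cat_take_drop all_pred1_nseq.
  by rewrite size_phi E.
have Ak : A < k by apply: count_lt; apply/phi_nseqP.
have kA : k - A < k.
  by rewrite -(dE c); apply: count_lt; apply/phi_nseqP.
have b1 := run_bound (fun e => eq_leq (cE e)) Ak _ Sc.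
have b2 := run_bound (fun e => eq_leq (dE e)) kA _ Sd.
have kE : k = n.+1 by lia.
by have := n_odd kE; have -> : k = 2 * A by [lia]; rewrite mul2n odd_double.
Qed.

Definition alt (c : bool) i := odd i (+) c.

Lemma stream_altD c q i : stream (alt c) (i + q * k) = stream (alt (odd q (+) c)) i.
Proof.
have k0 : 0 < k by lia.
by rewrite /stream addnC modnMDl divnMDl // /alt oddD addbAC addbC addbA.
Qed.

(** Images of alternating words alternate and are [k] times as long; dropping at most one letter
    restores the first letter. *)
Lemma S_alt_unbounded c : S (mkseq (alt c) 2) ->
  (forall i, stream (alt c) i.+1 = ~~ stream (alt c) i) ->
  forall d N, S (mkseq (alt d) N).
Proof.
move=> S2 flip; have G i : stream (alt c) i = alt (stream (alt c) 0) i.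
  by elim: i => [|i IH] //; rewrite flip IH /alt /=; case: (odd i); case: (stream _ 0).
have grow M : S (mkseq (alt c) M.+2).
  elim: M => [//|M /S_morph IH].
  have {}IH : S (mkseq (alt (stream (alt c) 0)) (k * M.+2)).
    rewrite (_ : mkseq _ _ = morph (mkseq (alt c) M.+2)) //.
    apply: (@eq_from_nth _ true) => [|i]; rewrite size_mkseq ?size_morph ?size_mkseq // => iM.
    by rewrite nth_mkseq // nth_morph_mkseq.
  pose e := stream (alt c) 0 != c.
  rewrite (@eq_mkseq _ (alt c) (fun i => alt (stream (alt c) 0) (e + i))).
    by apply: S_mkseq IH _; have : e <= 1 := leq_b1 _; nia.
  by move=> i; rewrite /alt oddD oddb /e; case: (odd i); case: (stream _ _); case: (c).
move=> d N; rewrite (@eq_mkseq _ (alt d) (fun i => alt c ((d != c) + i))).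
  by apply: S_mkseq (grow N) _; have : (d != c) <= 1 := leq_b1 _; lia.
by move=> i; rewrite /alt oddD oddb; case: (odd i); case: (d); case: (c).
Qed.

(* The stream of [phi c ++ phi (~~ c)] repeated has an even period [g < k], since [g]
   divides [2 * k] but not [k]; so one alternating block forces alternation everywhere. *)
Lemma alternating_unbounded r V W : 0 < r < k ->
  (forall i, i < n.+2 -> V i.+1 = ~~ V i) -> S (mkseq V n.+3) ->
  overlap r n.+2 V W -> forall N, desync N.
Proof.
move=> /andP [r0 rk] Valt SV H; set c := V 0; have k0 : 0 < k by lia.
have VE i : i < n.+3 -> V i = alt c i.
  elim: i => [|i IH] i_n; first by rewrite /alt.
  by rewrite Valt // IH 1?ltnW // /alt /=; case: (odd i); case: (c).
have E0 : phi (W 0) = drop r (phi c) ++ take r (phi (~~ c)) by rewrite H // Valt.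
have E1 : phi (W 1) = drop r (phi (~~ c)) ++ take r (phi c).
  by rewrite H // !Valt // negbK.
have nphi : phi (~~ c) <> phi c by move/phi_inj; case: (c).
have W1 : W 1 = ~~ W 0.
  have [WE|] := eqVneq (W 1) (W 0); last by case: (W 1); case: (W 0).
  case: nphi; move: E0; rewrite -WE E1 => /eqP; rewrite eqseq_cat ?size_drop ?size_phi //.
  case/andP => /eqP Ed /eqP Et.
  by rewrite -[LHS](cat_take_drop r) -[RHS](cat_take_drop r) Ed Et.
have ov N : overlap r N (alt c) (alt (W 0)).
  by move=> i _; rewrite /alt /=; case: (odd i); rewrite /= -?W1 ?negbK.
suff SA d N : S (mkseq (alt d) N) by move=> N; exists r, (alt c), (alt (W 0)); rewrite r0 rk.
pose G := stream (alt c).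
apply: (@S_alt_unbounded c).
  have -> : mkseq (alt c) 2 = mkseq V 2 by rewrite /mkseq /= !VE.
  exact: (@S_mkseq V 0 2 n.+3).
have nGk : ~ forall i, G (i + k) = G i.
  move=> E; apply: nphi; congr phi; apply: nth_phi_ext => j jk.
  have := E j; rewrite -[X in j + X]mul1n /G stream_altD.
  by rewrite -[j](add0n j) -(mul0n k) !streamE.
have G2 i : G (i + 2 * k) = G i by rewrite /G stream_altD.
(* Shifting by [r] gives the stream of [alt (W 0)]; if [W 0] is not [c], one more block returns to
   [alt c]. *)
have [rho rho0 [rhoN Grho]] : exists2 rho, 0 < rho < 2 * k &
    rho != k /\ forall i, G (i + rho) = G i.
  have shift i : stream (alt (W 0)) i = G (r + i).
    by apply: (iffLR (overlapP i.+1 _ _ rk)) => //; nia.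
  have [W0|W0] := eqVneq (W 0) c.
    exists r; first lia; split; first lia.
    by move=> i; rewrite addnC -shift W0.
  exists (r + k); first lia; split; first lia.
  move=> i; rewrite addnCA -shift -[X in i + X]mul1n stream_altD /G.
  by congr (stream (alt _) i); move: W0; case: (W 0); case: (c).
have {Grho}Gg : forall i, G (i + gcdn rho (2 * k)) = G i.
  by apply: periodic_gcd => //; lia.
have gd : gcdn rho (2 * k) %| 2 * k := dvdn_gcdr _ _.
have gr : gcdn rho (2 * k) <= rho by apply: dvdn_leq; [lia|exact: dvdn_gcdl].
move: (gcdn rho (2 * k)) Gg gd gr => g Gg gd gr.
have Gmul q i : G (i + q * g) = G i.
  by elim: q => [|q IH]; rewrite ?addn0 // mulSn [g + _]addnC addnA Gg.
have gNk : ~~ (g %| k).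
  by apply/negP => /dvdnP [q kq]; apply: nGk => i; rewrite {1}kq.
have g2 : 2 %| g.
  rewrite -[_ %| _]negbK; apply/negP; rewrite dvdn2 negbK => og; case/negP: gNk.
  by rewrite -(@Gauss_dvdr g 2 k) // coprimen2.
have [m gm] : exists m, g = 2 * m by case/dvdnP: g2 => m ->; exists m; rewrite mulnC.
have mk : m %| k by move: gd; rewrite gm dvdn_pmul2l.
have gk : g < k.
  (* With [k = t * m] and [g = 2 * m]: [t = 1] contradicts [g < 2 * k], and [t = 2] gives
     [g = k]. *)
  case/dvdnP: mk => [[|[|[|t]]] kt]; [lia|lia| |].
    by case/negP: gNk; rewrite gm kt.
  by have := leq_addl (t * m) (3 * m); rewrite -mulnDl addn3 -kt; lia.
have m0 : 0 < m by case: (m) mk => //; rewrite dvd0n; lia.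
have [m1|m1] := leqP m 1.
  have gE : g = 2 by lia.
  have G02 i : G i.+2 = G i by rewrite -[in RHS]Gg gE addn2.
  have G01 : G 1 = ~~ G 0.
    have [E|] := eqVneq (G 1) (G 0); last by case: (G 1); case: (G 0).
    case: nGk; have G0 i : G i = G 0 /\ G i.+1 = G 0.
      by elim: i => [//|i [IH1 IH2]]; rewrite G02.
    by move=> i; rewrite (G0 i).1 (G0 (i + k)).1.
  by elim=> [|i IH]; rewrite ?G02 ?IH ?negbK.
have [_ n2k] : k * (m - 1) < n /\ 2 * k <= n + 3 by apply: n_div => //; lia.
have := desubstitution SV; rewrite size_mkseq => /(_ isT) [V' [r' [_ rk' H' le _]]].
(* Desubstituting [V] itself, the block of index 1 lies wholly inside [V], so [phi e] alternates;
   [q] is a place of [e] in [alt c]. *)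
pose e := nth true V' 1; pose q : nat := e != c.
have block j : j < k -> G (q * k + j) = alt c (k + j - r').
  move=> jk; rewrite /G streamE //; have -> : alt c q = e.
    by rewrite /q /alt oddb; case: (e); case: (c).
  have [kj iN] : r' <= k + j /\ k + j - r' < n.+3 by clear -rk' n2k jk; lia.
  have := H' _ iN; rewrite subnKC // nth_mkseq // VE // => ->.
  by rewrite -[k in k + j]mul1n divnMDl // modnMDl divn_small // modn_small // addn0.
have g0 : 0 < g by lia.
(* Modulo [g], both [i] and [i.+1] are moved into that block, as [t.+1 <= g < k]. *)
move=> i; have [t tg Et] := hits_residue (q * k) (ltn_pmod i g0).
have Et1 : i.+1 %% g = (q * k + t.+1) %% g by rewrite -addn1 -modnDml -Et modnDml -addnA addn1.
rewrite -/G (periodic_modn _ Gg) Et1 -(periodic_modn _ Gg).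
rewrite [G i](periodic_modn _ Gg) -Et -(periodic_modn _ Gg).
have tk : t.+1 < k by apply: leq_ltn_trans gk.
rewrite !block ?(ltnW tk) // addnS subSn ?/alt ?addNb //.
by apply: leq_trans (ltnW rk') (leq_addr _ _).
Qed.

Lemma desync_unbounded : desync n.+2 -> forall N, desync N.
Proof.
case=> r [V [W [rk SV SW H]]].
case: (overlap_run rk H SV SW) => [[c [e [Sc Se rotE]]]|alt]; last first.
  exact: alternating_unbounded rk alt SV H.
have [ec|ne] := eqVneq e c.
  rewrite ec in rotE; have Sall := self_rotation_unbounded rk rotE Sc.
  move=> N; exists r, (fun=> c), (fun=> c).
  by split=> //; rewrite (@mkseq_const _ c).
have ec : e = ~~ c by move: ne; case: (e); case: (c).
rewrite ec in Se rotE; case: (no_conjugate_runs rotE _ Se).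
exact: S_nseq_le Sc (leqnSn _).
Qed.

End Threshold.

(** * From interpretations to desynchronized pairs, and to a delay *)

Lemma unsync_desync u p v s p' v' s' N :
  interpretation phi [:: la] u p v s -> interpretation phi [:: la] u p' v' s' ->
  size p <> size p' %[mod k] -> k * N.+1 <= (size u).+1 -> desync N.
Proof.
move=> [Sv Ev] [Sv' Ev'] ne uN; have k0 : 0 < k by lia.
(* [dl] is the distance from the start of [u] to the first cut of [v']. At most [k - 1] letters are
   lost, so [N] full blocks remain in [u]. *)
have [i0' [dl dlk i0E]] : exists i0', exists2 dl, dl < k & size p' + dl = k * i0'.
  exists ((size p' + k.-1) %/ k), (k.-1 - (size p' + k.-1) %% k); first by lia.
  have := divn_eq (size p' + k.-1) k; have := ltn_pmod (size p' + k.-1) k0.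
  by rewrite mulnC; move: (k * _) (_ %% k) => a b; lia.
have [i0 [r rk i0r]] : exists i0, exists2 r, r < k & size p + dl = k * i0 + r.
  by exists ((size p + dl) %/ k), ((size p + dl) %% k); rewrite ?ltn_mod // mulnC -divn_eq.
have r0 : 0 < r.
  rewrite lt0n; apply/eqP => rE; apply/ne/eqP.
  by rewrite -(eqn_modDr dl) i0r i0E rE addn0 !modnMr.
have szv : k * size v = size p + size u + size s.
  by rewrite -size_morph Ev !size_cat addnA.
have szv' : k * size v' = size p' + size u + size s'.
  by rewrite -size_morph Ev' !size_cat addnA.
rewrite mulnS in uN.
have lv : i0 + N.+1 <= size v.
  by rewrite -ltnS -(ltn_pmul2l k0) !mulnS mulnDr mulnS; lia.
have lv' : i0' + N <= size v' by rewrite -(leq_pmul2l k0) mulnDr; lia.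
have uE a b c (x : seq bool) i : i < size u -> a ++ u ++ b = x -> c = size a + i ->
    nth true u i = nth true x c.
  move=> iu <- ->; rewrite nth_cat; have -> : size a + i < size a = false by lia.
  by rewrite addKn nth_cat iu.
have sub w j (f := fun i => nth true w (j + i)) M : S w -> j + M <= size w -> S (mkseq f M).
  by move=> Sw jw; apply: (@S_mkseq (nth true w) j M (size w)); rewrite ?mkseq_nth.
have strE w j i : k * j + i < k * size w ->
    stream (fun i => nth true w (j + i)) i = nth true (morph w) (k * j + i).
  by move=> iw; rewrite nth_morph // mulnC divnMDl // modnMDl.
exists r, (fun i => nth true v (i0 + i)), (fun i => nth true v' (i0' + i)).
split; [by rewrite r0|exact: sub|exact: sub|].
apply/overlapP => // i iN; rewrite !strE; try lia.
rewrite -(uE _ _ _ _ (dl + i) _ (esym Ev')) -?(uE _ _ _ _ (dl + i) _ (esym Ev)) //; lia.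
Qed.

Lemma cut_at u p v s j : interpretation phi [:: la] u p v s -> j <= size u ->
  k %| size p + j -> exists2 i, i <= size v & morph (take i v) = p ++ take j u.
Proof.
move=> [_ E] ju /dvdnP [i iE]; have k0 : 0 < k by lia.
have iv : i <= size v.
  by rewrite -(leq_pmul2l k0) -size_morph E mulnC -iE !size_cat leq_add2l; lia.
exists i => //; have := congr1 (take (k * i)) E.
rewrite -{1}(cat_take_drop i v) morph_cat take_size_cat ?size_morph ?size_takel // => ->.
rewrite mulnC -iE take_cat; have -> : size p + j < size p = false by lia.
by rewrite addKn takel_cat.
Qed.

(** Without desynchronization all interpretations have [size p] in one class modulo [k], so the
    first cut after the start of [u] is common to all. *)
Lemma sync_delay_of_no_desync N B : ~ desync N -> 0 < N -> k * N.+1 <= B.+2 -> 0 < B ->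
  sync_delay phi [:: la] B.
Proof.
move=> nd N0 BN B0; split=> // u Su Bu; have k0 : 0 < k by lia.
have [|v0 Sv0 /infixP [p0 [s0 E0]]] := S_preimage Su; first by lia.
have I0 : interpretation phi [:: la] u p0 v0 s0 by [].
have ku : k <= size u by nia.
pose j := k - size p0 %% k.
have ju : j <= size u by apply: leq_trans ku; exact: leq_subr.
have cut p v s : interpretation phi [:: la] u p v s -> k %| size p + j.
  move=> I; have [E|/eqP ne] := eqVneq (size p %% k) (size p0 %% k).
    by rewrite /dvdn -modnDml E subnKC ?modnn // ltnW // ltn_mod.
  by case: nd; apply: unsync_desync I I0 ne _; lia.
exists j; split=> // p v s p' v' s' I I'.
have [i iv Ei] := cut_at I ju (cut _ _ _ I).
by have [i' iv' Ei'] := cut_at I' ju (cut _ _ _ I'); exists i, i'.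
Qed.

End Language.

(** * The three bounds, from three choices of the threshold [n] *)

Theorem theorem1 (k : nat) (phi : bool -> seq bool) (d Zmin : nat) :
  2 <= k ->
  minimal_alphabet phi [:: la] ->
  circular phi [:: la] ->
  uniform phi k ->
  (* d is the least divisor of k greater than 1 *)
  1 < d -> d %| k -> (forall e, 1 < e -> e %| k -> d <= e) ->
  is_Zmin phi [:: la] Zmin ->
  [/\ (k = 2 -> Zmin <= 8),
      (prime k -> odd k -> Zmin <= k ^ 2 + 3 * k - 4) &
      (k <> 2 -> ~~ (prime k && odd k) ->
         Zmin <= k ^ 2 * (k %/ d - 1) + 5 * k - 4)].
Proof.
move=> k2 alph [_ [inj [Z delayZ]]] [sa sb] d1 dk dmin [_ minZ].
have sz c : size (phi c) = k by case: c.
have phi_inj : injective phi.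
  have neq : phi la <> phi lb.
    move=> E; have := inj _ _ alph.1 alph.2.
    by rewrite /morph /= E => /(_ erefl).
  by move=> [] [] // E; case: neq.
have key n : k <= n.+1 -> (k = n.+1 -> odd k) ->
    (forall m, m %| k -> 1 < m < k -> k * (m - 1) < n /\ 2 * k <= n + 3) ->
    Zmin <= k * n + 4 * (k - 1).
  (* With [N = n.+2] the requirement is [k * (n + 3) <= B + 2], met with slack [k - 2]. *)
  move=> H1 H2 H3; apply: minZ; apply: (@sync_delay_of_no_desync phi k k2 sz n.+2).
  - move=> D; apply: (sync_delay_no_desync k2 sz delayZ).
    exact: (desync_unbounded k2 sz phi_inj alph H1 H2 H3 D).
  - by [].
  - by rewrite !mulnS; lia.
  by lia.
have prime_div m : prime k -> m %| k -> 1 < m < k -> k * (m - 1) < k.-1 /\ 2 * k <= k.-1 + 3.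
  by move=> /primeP [_ pk] /pk /orP [] /eqP ->; lia.
split=> [kE|pk ok|k_neq2 npo].
(* [n = 1] would give [k = n.+1] with [k] even, so [n = 2] is taken. *)
- apply: leq_trans (key 2 _ _ _) _; rewrite ?kE // => m _; lia.
- apply: leq_trans (key k.-1 _ _ _) _ => [|//|m|]; [lia|exact: prime_div|].
  by rewrite -mulnn; nia.
have kd : k = k %/ d * d by rewrite divnK.
set q := k %/ d in kd *.
(* [q] is the largest proper divisor of [k]. The second bound is tight for [q = 2], where [d = 2]
   and [k = 4]. *)
have big m : m %| k -> 1 < m < k -> m <= q /\ 2 * k <= k * (q - 1) + 4.
  move=> mk /andP [m1 mltk]; case/dvdnP: (mk) => t kt.
  have dt : d <= t by apply: dmin; [nia|rewrite kt dvdn_mulr].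
  have mq : m <= q by rewrite -(leq_pmul2r (ltnW d1)) -kd kt mulnC leq_mul2r dt orbT.
  split=> //; have [q3|q2] := leqP 3 q.
    by have : k * 2 <= k * (q - 1); [rewrite leq_mul2l; lia|lia].
  have qE : q = 2 by lia.
  have d2 : d <= 2 by apply: dmin => //; rewrite kd qE dvdn_mulr.
  by rewrite qE; rewrite qE in kd; lia.
(* Otherwise [k = d] is prime, hence 2 or odd, and both are excluded. *)
have q2 : 1 < q.
  have [q1|//] := leqP q 1; case/negP: npo.
  have kE : k = d by move: kd; case: (q) q1 => [|[|//]] _; lia.
  have pk : prime k.
    apply/primeP; split=> // e ek; have [e1|e1] := leqP e 1.
      by have := dvdn_gt0 (ltnW k2) ek; case: (e) e1 => [|[|]].
    have := dmin e e1 ek; have := dvdn_leq (ltnW k2) ek; rewrite -kE => ? ?.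
    by apply/orP; right; rewrite eqn_leq; apply/andP.
  by rewrite pk; case: (even_prime pk).
have kq : k <= k * (q - 1) by rewrite leq_pmulr // subn_gt0.
apply: leq_trans (key (k * (q - 1)).+1 _ _ _) _; try lia.
move=> m mk mb; have [mq kq4] := big m mk mb.
by split; [rewrite ltnS leq_mul2l leq_sub2r ?orbT|lia].
Qed.
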